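(* Let $\alpha\in(0,1)$. There exist a time $T_\star>0$, a function $u_0\in C^\infty(\mathbb{R})$, a smooth solution $u:\mathbb{R}\times[0,T_\star)\to\mathbb{R}$ of the time-fractional Burgers' equation $$\begin{cases} {}^C D^\alpha_{0,+} u(x,t) + u(x,t)\,\partial_x u(x,t)=0 & \text{for all } x\in\mathbb{R} \text{ and } t\in(0,T_\star),\\ u(x,0)=u_0(x),\end{cases}$$ and a sequence $t_n\nearrow T_\star$ as $n\to+\infty$ such that $$\lim_{n\to+\infty} u(x,t_n)=\begin{cases} +\infty & \text{if } x\in(-\infty,0),\\ -\infty & \text{if } x\in(0,+\infty).\end{cases}$$
   Context: For $\alpha\in(0,1)$, the left-Caputo-derivative of order $\alpha$ with initial time $t_0$ is defined, for $t\in(t_0,+\infty)$, by $${}^C D^\alpha_{t_0,+} f(t):=\frac{1}{\Gamma(1-\alpha)}\int_{t_0}^t \frac{\dot f(\tau)}{(t-\tau)^\alpha}\,d\tau,$$ where $\Gamma$ is the Euler Gamma function and $\dot f$ is the derivative of $f$. In the equation, ${}^C D^\alpha_{0,+}u(x,t)$ denotes the left-Caputo-derivative with initial time $t_0=0$ of the function $t\mapsto u(x,t)$, for fixed $x$.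
   Formalization: ''Smooth solution'' is taken as jointly smooth for 0<t<T⋆, and smooth in x with all x-derivatives continuous up to t=0; smoothness in t at t=0 is not required, since a solution also C¹ in t up to t=0 would have constant initial datum and could not blow up as claimed. *)

(* Defs.v *)
From HB Require Import structures.
From mathcomp Require Import all_boot all_order all_algebra.
From mathcomp Require Import all_classical all_reals all_analysis.

Set Implicit Arguments.
Unset Strict Implicit.
Unset Printing Implicit Defensive.

Import Order.TTheory GRing.Theory Num.Theory.
Import numFieldNormedType.Exports.

Local Open Scope ring_scope.
Local Open Scope classical_set_scope.

Section Caputo.
Context {R : realType}.

(* A convergent integral for s > 0; Rintegral returns a default value
   otherwise. *)
Definition Gamma (s : R) : R :=
  \int[lebesgue_measure]_(r in `]0, +oo[) (r `^ (s - 1) * expR (- r)).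

Definition caputo_integrand (alpha : R) (f : R -> R) (t tau : R) : R :=
  f^`()%classic tau / (t - tau) `^ alpha.

Definition has_caputo (alpha t0 : R) (f : R -> R) (t : R) : Prop :=
  (forall tau, t0 < tau < t -> derivable f tau 1) /\
  lebesgue_measure.-integrable `]t0, t[
    (EFin \o caputo_integrand alpha f t).

(* Meaningful only under has_caputo alpha t0 f t. *)
Definition caputo (alpha t0 : R) (f : R -> R) (t : R) : R :=
  (Gamma (1 - alpha))^-1 *
  \int[lebesgue_measure]_(tau in `]t0, t[) caputo_integrand alpha f t tau.

End Caputo.

Section Smoothness.
Context {R : realType}.

Definition smooth1 (f : R -> R) : Prop :=
  forall (n : nat) (x : R), derivable (f^`(n)) x 1.

Definition partial_x (u : R -> R -> R) : R -> R -> R :=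
  fun x t => (u^~ t)^`() x.

Definition partial_t (u : R -> R -> R) : R -> R -> R :=
  fun x t => (u x)^`() t.

(* w lists the variables of differentiation: true for t, false for x. *)
Fixpoint iter_partial (w : seq bool) (u : R -> R -> R) : R -> R -> R :=
  if w is b :: w' then
    (if b then partial_t else partial_x) (iter_partial w' u)
  else u.

(* C^oo on D, meant for an open D: the mixed partial derivatives of all orders,
   in every order of differentiation, exist and are continuous on D. *)
Definition smooth2 (D : set (R * R)) (u : R -> R -> R) : Prop :=
  forall w : seq bool,
    (forall p, D p -> derivable ((iter_partial w u)^~ p.2) p.1 1 /\
                      derivable (iter_partial w u p.1) p.2 1) /\
    {within D, continuous (fun p : R * R => iter_partial w u p.1 p.2)}.

(* Functions on the line times [0, T[ are represented by total functions whose
   values at other times are irrelevant. *)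

(* Smoothness in t is required for positive times only: a solution of the
   Burgers equation that is C^1 in t up to t = 0 has a Caputo derivative
   vanishing as t tends to 0, which forces u0 * u0^`() = 0 and hence a constant
   u0. All the derivatives in x are continuous up to t = 0. *)
Definition smooth_until (T : R) (u : R -> R -> R) : Prop :=
  [/\ smooth2 [set p | 0 < p.2 < T] u,
      forall t : R, 0 <= t < T -> smooth1 (u^~ t) &
      forall n : nat, {within [set p | 0 <= p.2 < T],
        continuous (fun p : R * R => (u^~ p.2)^`(n) p.1)}].

Definition burgers_solution (alpha T : R) (u0 : R -> R) (u : R -> R -> R)
    : Prop :=
  (forall x t : R, 0 < t < T ->
     has_caputo alpha 0 (u x) t /\
     caputo alpha 0 (u x) t + u x t * partial_x u x t = 0) /\
  (forall x : R, u x 0 = u0 x).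

End Smoothness.

(* Main.v *)
Require Import Defs.
From HB Require Import structures.
From mathcomp Require Import all_boot all_order all_algebra.
From mathcomp Require Import all_classical all_reals all_analysis.
From mathcomp Require Import measurable_realfun ring lra.
Import Order.TTheory GRing.Theory Num.Theory.
Import numFieldNormedType.Exports.
Local Open Scope ring_scope.
Local Open Scope classical_set_scope.

(**
The ansatz u(x,t) = - x v(t) reduces the equation to the Caputo-Riccati equation
D^alpha v = v^2, solved by v(t) = sum_n c_n t^(alpha n) with c_0 = 1 and
a_n c_(n+1) = sum_(k <= n) c_k c_(n-k), where a_n t^(alpha n) is the Caputo
derivative of t^(alpha (n+1)); a_n is written with the integral
int_0^1 x^(g-1) (1-x)^(-alpha) dx, so that its evaluation by Gamma is not needed.
Since a_n <= A (n+1), c_n >= A^(-n) and the radius of convergence rho in the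
variable s = t^alpha is finite. Since a_n -> +oo and c_n >= 0, a power series
bounded at s still converges slightly beyond s; so rho > 0 and sum_n c_n s^n must
tend to +oo as s tends to rho. Hence v blows up at T = rho^(1/alpha).
*)

(** The obstacle is the endpoint: a power series with nonnegative coefficients may well converge at
    its radius of convergence, as [sum_n s^n / n^2] does, and would then have a finite limit there.
    What excludes this is the quadratic recursion together with [a_n -> +oo]: past a large index the
    recursion feeds back only a small multiple of the square of the sum, so a bound at [s] survives
    a small increase of [s]. The sign in [- x v(t)] matters: with [+ x v(t)] the equation would be
    [D^alpha v = - v^2] and the coefficients would alternate in sign. Nonnegativity is used
    throughout: convergence becomes boundedness of partial sums, Cauchy products are compared by
    inclusion of index sets, and series are integrated term by term by monotone convergence. *)

Lemma triangular_sum (R : pzRingType) (p q : nat -> R) (n : nat) :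
  \sum_(0 <= m < n) \sum_(0 <= k < m.+1) p k * q (m - k)%N =
  \sum_(0 <= k < n) \sum_(0 <= l < n - k) p k * q l.
Proof.
elim: n => [|n IH]; first by rewrite !big_nil.
rewrite big_nat_recr //= IH [RHS]big_nat_recr //= [in RHS]subSnn big_nat1.
rewrite [in X in _ + X = _]big_nat_recr //= subnn addrA; congr (_ + _).
rewrite -big_split /= !big_nat; apply: eq_bigr => k /andP[_ kn].
by rewrite subSn ?(ltnW kn)// big_nat_recr.
Qed.

(** * Blow-up of power series with a quadratic convolution recursion *)

Section PowerSeriesBlowup.
Context {R : realType}.
Variables (a c : nat -> R).
Hypotheses (a_gt0 : forall n, 0 < a n) (c0 : c 0%N = 1).
Hypothesis cS : forall n,
  c n.+1 = (\sum_(0 <= k < n.+1) c k * c (n - k)%N) / a n.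

Lemma conv_coef_ge0 (n : nat) : 0 <= c n.
Proof.
elim/ltn_ind: n => -[|n] IH; first by rewrite c0.
rewrite cS divr_ge0 ?(ltW (a_gt0 _))//.
rewrite big_nat sumr_ge0// => k /andP[_ kn].
by rewrite mulr_ge0 ?IH// ltnS leq_subr.
Qed.

Lemma conv_pseries_nd (s : R) : 0 <= s -> nondecreasing_seq (pseries c s).
Proof.
move=> s0; apply: nondecreasing_series => n _ _.
by rewrite mulr_ge0 ?exprn_ge0 ?conv_coef_ge0.
Qed.

Lemma conv_pseries_ge0 (s : R) (n : nat) : 0 <= s -> 0 <= pseries c s n.
Proof.
move=> s0; rewrite sumr_ge0// => k _.
by rewrite mulr_ge0 ?exprn_ge0 ?conv_coef_ge0.
Qed.

Lemma conv_pseries_triangle (s : R) (n : nat) :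
  \sum_(0 <= m < n) (\sum_(0 <= k < m.+1) c k * c (m - k)%N) * s ^+ m =
  \sum_(0 <= k < n) \sum_(0 <= l < n - k) (c k * s ^+ k) * (c l * s ^+ l).
Proof.
rewrite -(triangular_sum _ (fun k => c k * s ^+ k) (fun k => c k * s ^+ k)).
apply: eq_bigr => m _; rewrite mulr_suml !big_nat; apply: eq_bigr => k.
by rewrite ltnS => /andP[_ km]; rewrite mulrACA -exprD subnKC.
Qed.

(** The left side sums over the triangle [k + l < n], which lies in the square [k, l < n] of the
    right side, and all terms are nonnegative. *)
Lemma conv_pseries_sq (s : R) (n : nat) : 0 <= s ->
  \sum_(0 <= m < n) (\sum_(0 <= k < m.+1) c k * c (m - k)%N) * s ^+ m <=
  pseries c s n ^+ 2.
Proof.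
move=> s0; have t0 k : 0 <= c k * s ^+ k.
  by rewrite mulr_ge0 ?exprn_ge0 ?conv_coef_ge0.
rewrite conv_pseries_triangle.
rewrite expr2 /pseries /series /= mulr_suml ler_sum// => k _.
rewrite -mulr_sumr ler_wpM2l//.
by apply: (conv_pseries_nd s s0); exact: leq_subr.
Qed.

(** Beyond index [K] each coefficient is a convolution divided by at least [L], so the tail is at
    most [s / L] times a partial sum of the Cauchy square. A large [L] thus makes the feedback weak,
    at the cost of a longer head. *)
Lemma conv_pseries_step (K N : nat) (L s : R) : 0 <= s -> 0 < L ->
  (forall n, (K <= n)%N -> L <= a n) ->
  pseries c s N.+1 <= pseries c s K.+1 + s / L * pseries c s N ^+ 2.
Proof.
move=> s0 L0 La; have [NK|KN] := leqP N K.
  rewrite (le_trans (conv_pseries_nd s s0 _ _ (NK : (N.+1 <= K.+1)%N)))//.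
  by rewrite lerDl mulr_ge0// ?exprn_ge0 ?conv_pseries_ge0// divr_ge0 ?(ltW L0).
rewrite {1}/pseries /series/= (@big_cat_nat _ _ _ K.+1)//=; last exact: ltnW.
rewrite lerD2l big_add1/=.
apply: (@le_trans _ _ (s / L * \sum_(0 <= m < N)
    (\sum_(0 <= k < m.+1) c k * c (m - k)%N) * s ^+ m)); last first.
  by rewrite ler_wpM2l ?conv_pseries_sq// divr_ge0 ?(ltW L0).
have t0 m : 0 <= (\sum_(0 <= k < m.+1) c k * c (m - k)%N) * s ^+ m.
  rewrite mulr_ge0 ?exprn_ge0// sumr_ge0// => k _.
  by rewrite mulr_ge0 ?conv_coef_ge0.
apply: (@le_trans _ _ (s / L * \sum_(K <= m < N)
    (\sum_(0 <= k < m.+1) c k * c (m - k)%N) * s ^+ m)); last first.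
  rewrite ler_wpM2l ?divr_ge0 ?(ltW L0)//.
  by rewrite [leRHS](@big_cat_nat _ _ _ K)//= ?(ltnW KN)// lerDr sumr_ge0.
rewrite mulr_sumr !big_nat; apply: ler_sum => m /andP[Km _].
rewrite cS exprS.
set S := \sum_(_ <= _ < _) _.
have -> : S / a m * (s * s ^+ m) = s * (S * s ^+ m) / a m by ring.
have -> : s / L * (S * s ^+ m) = s * (S * s ^+ m) / L by ring.
apply: ler_wpM2l; first by rewrite mulr_ge0 ?t0.
by rewrite lef_pV2 ?posrE ?La.
Qed.

Lemma continuous_pseries_partial (p : nat -> R) (N : nat) :
  continuous (fun s => pseries p s N).
Proof.
move=> s; rewrite /pseries /series/=.
elim: N => [|N IH].
  by under eq_fun do rewrite big_nil; exact: cvg_cst.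
under eq_fun do rewrite big_nat_recr//=.
by apply: cvgD => //; apply: cvgM; [exact: cvg_cst|exact: exprn_continuous].
Qed.

Hypothesis a_cvgy : a @ \oo --> +oo.

(* If the partial sums at [rho] are at most [M], then far coefficients satisfy
   a fixed point inequality that keeps the partial sums below [M + 1] slightly
   beyond [rho]. *)
Lemma conv_pseries_extend (rho M : R) : 0 <= rho ->
  (forall N, pseries c rho N <= M) ->
  exists2 s, rho < s & forall N, pseries c s N <= M + 1.
Proof.
move=> rho0 bM.
have M0 : 0 <= M by apply: le_trans (bM 0%N); exact: conv_pseries_ge0.
(* Half of the margin 1 goes to the head, by continuity of a polynomial at [rho], and half to the
   quadratic term: [s / L * (M + 1) ^+ 2 <= 2^-1] as soon as [s <= rho + 1]. *)
pose L := 2 * (rho + 1) * (M + 1) ^+ 2.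
have L0 : 0 < L by rewrite /L !mulr_gt0// ?exprn_gt0; lra.
have [K _ KL] : \forall n \near \oo, L <= a n by move/cvgryPge : a_cvgy; apply.
have : \forall s \near rho^'+, pseries c s K.+1 < M + 2^-1.
  have /cvg_at_right_filter h := continuous_pseries_partial c K.+1 rho.
  by apply: (cvgr_lt _ h); rewrite (le_lt_trans (bM _))// ltrDl invr_gt0.
move=> near_s.
near (rho^'+) => s.
have rs : rho < s by near: s; exact: nbhs_right_gt.
have s1 : s <= rho + 1 by near: s; apply: nbhs_right_le; rewrite ltrDl.
exists s => //; elim => [|N IH].
  by rewrite /pseries /series/= big_nil; lra.
have s0 : 0 <= s by apply: le_trans (ltW rs).
rewrite (le_trans (conv_pseries_step K N L s s0 L0 KL))//.
have -> : M + 1 = (M + 2^-1) + 2^-1 by lra.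
apply: lerD; first by apply: ltW; near: s.
rewrite mulrAC ler_pdivrMr//.
have PN0 := conv_pseries_ge0 s N s0.
have h1 : pseries c s N ^+ 2 <= (M + 1) ^+ 2.
  by rewrite lerXn2r// ?nnegrE; lra.
have -> : 2^-1 * L = (rho + 1) * (M + 1) ^+ 2 by rewrite /L; lra.
by apply: ler_pM => //; rewrite exprn_ge0.
Unshelve. all: by end_near. Qed.

(** Each of the [n + 1] products in the convolution is at least [A ^- n] by induction, and their
    number cancels the linear growth allowed to [a n]. *)
Lemma conv_coef_lower (A : R) : 0 < A ->
  (forall n, a n <= A * n.+1%:R) -> forall n, A ^- n <= c n.
Proof.
move=> A0 aA; elim/ltn_ind => -[|n] IH; first by rewrite c0 expr0 invr1.
rewrite cS ler_pdivlMr//.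
apply: (@le_trans _ _ (A ^- n * n.+1%:R)).
  rewrite exprS invfM mulrC mulrA ler_pdivrMr ?exprn_gt0//.
  by rewrite mulrAC mulVf ?gt_eqF ?exprn_gt0// mul1r ler_pdivrMr// mulrC.
rewrite mulr_natr -[X in _ *+ X](subn0 n.+1) -sumr_const_nat !big_nat.
apply: ler_sum => k /andP[_]; rewrite ltnS => kn.
have -> : A ^- n = A ^- k * A ^- (n - k).
  by rewrite -[in LHS](subnKC kn) exprD invfM.
by apply: ler_pM; rewrite ?invr_ge0 ?exprn_ge0 ?(ltW A0) ?IH// ltnS leq_subr.
Qed.

(** The set [E] of points with bounded partial sums is an interval from 0, is bounded, and by
    [conv_pseries_extend] has no largest element. Its supremum is [rho], and partial sums are
    unbounded there. *)
Lemma conv_pseries_blowup (A : R) : 0 < A ->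
  (forall n, a n <= A * n.+1%:R) ->
  exists rho : R, [/\ 0 < rho,
    forall s, 0 <= s < rho -> cvgn (pseries c s) &
    limn (pseries c s) @[s --> rho^'-] --> +oo].
Proof.
move=> A0 aA.
pose E := [set s | 0 <= s /\ exists M, forall N, pseries c s N <= M].
have E0 : E 0.
  split=> //; exists 1 => -[|N]; first by rewrite /pseries /series/= big_nil.
  rewrite /pseries /series/= big_nat_recl//= c0 expr0 mulr1 big1 ?addr0//.
  by move=> i _; rewrite expr0n mulr0.
have Emono s s' : 0 <= s <= s' -> E s' -> E s.
  move=> /andP[s0 ss'] [s'0 [M bM]]; split=> //; exists M => N.
  apply: le_trans (bM N); apply: ler_sum => k _.
  by rewrite ler_wpM2l ?conv_coef_ge0// lerXn2r.
(* At [A] every term [c k * A ^+ k] is at least 1, so the [N]-th partial sum is at least [N]. *)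
have ubE : ubound E A.
  move=> s Es; rewrite leNgt; apply/negP => As.
  have [_ [M bM]] : E A by apply: Emono Es; rewrite (ltW A0) ltW.
  have : 0 <= M by apply: le_trans (bM 0%N); apply: conv_pseries_ge0; exact: ltW.
  move=> /archi_boundP.
  set N := Num.bound M; rewrite ltNge => /negP; apply.
  apply: le_trans (bM N); rewrite -[leLHS]mulr1 mulr_natl -[X in _ *+ X](subn0 N).
  rewrite -sumr_const_nat; apply: ler_sum => k _.
  rewrite -[leLHS](@mulVf _ (A ^+ k)) ?gt_eqF ?exprn_gt0//.
  by rewrite ler_wpM2r ?exprn_ge0 ?(ltW A0)// conv_coef_lower.
have supE : has_sup E by split; [exists 0|exists A].
have Esup s : E s -> s <= sup E by move=> Es; apply: ub_le_sup Es; case: supE.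
have sup_ge0 : 0 <= sup E by exact: Esup.
have Eext s : E s -> exists2 s', s < s' & E s'.
  move=> [s0 [M bM]]; have [s' ss' bs'] := conv_pseries_extend _ _ s0 bM.
  by exists s' => //; split; [exact: le_trans (ltW ss')|exists (M + 1)].
have nEsup : ~ E (sup E).
  by move=> /Eext[s' + /Esup]; rewrite ltNge => /negP.
have Elt s : 0 <= s < sup E -> E s.
  move=> /andP[s0 sE]; have sE0 : 0 < sup E - s by rewrite subr_gt0.
  have [e Ee se] := sup_adherent sE0 supE.
  by apply: Emono Ee; rewrite s0/=; lra.
have Ecvg s : 0 <= s < sup E -> cvgn (pseries c s).
  move=> /[dup] /Elt[s0 [M bM]] _; apply: nondecreasing_is_cvgn.
    exact: conv_pseries_nd.
  by exists M => _ [N _ <-].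
have sup_gt0 : 0 < sup E.
  by have [s' s'0 /Esup] := Eext _ E0; exact: lt_le_trans.
exists (sup E); split => //.
apply/cvgryPge => M.
(* One partial sum exceeding [M] at the supremum suffices: as a polynomial it still exceeds [M]
   slightly to the left, where the full sum dominates it. *)
have [N MN] : exists N, M < pseries c (sup E) N.
  apply: contrapT => /forallNP h; apply: nEsup; split=> //; exists M => N.
  by rewrite leNgt; apply/negP/h.
have : \forall s \near (sup E)^'-, M < pseries c s N.
  have /cvg_at_left_filter h := continuous_pseries_partial c N (sup E).
  exact: (cvgr_gt _ h).
move=> nearN; near=> s.
have s0 : 0 <= s by apply: ltW; near: s; exact: nbhs_left_gt.
have sE : s < sup E by near: s; exact: nbhs_left_lt.
have MNs : M < pseries c s N by near: s.
apply: (le_trans (ltW MNs)); apply: nondecreasing_cvgn_le.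
  exact: conv_pseries_nd.
by apply: Ecvg; rewrite s0.
Unshelve. all: by end_near. Qed.

(** Squeeze: the triangle of size [n] lies in the square of side [n], which lies in the triangle of
    size [2n]. *)
Lemma conv_pseries_sq_cvg (s : R) : 0 <= s -> cvgn (pseries c s) ->
  pseries (fun m => \sum_(0 <= k < m.+1) c k * c (m - k)%N) s @ \oo -->
  limn (pseries c s) ^+ 2.
Proof.
move=> s0 cs; set d := (X in pseries X s @ \oo --> _).
have d0 k : 0 <= d k * s ^+ k.
  rewrite mulr_ge0 ?exprn_ge0// sumr_ge0// => j _.
  by rewrite mulr_ge0 ?conv_coef_ge0.
have ndd : nondecreasing_seq (pseries d s).
  by apply: nondecreasing_series => n _ _; exact: d0.
have le_sq n : pseries d s n <= pseries c s n ^+ 2 by exact: conv_pseries_sq.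
have sq_le n : pseries c s n ^+ 2 <= pseries d s (n + n).
  rewrite [leRHS]conv_pseries_triangle.
  have t0 k : 0 <= c k * s ^+ k.
    by rewrite mulr_ge0 ?exprn_ge0 ?conv_coef_ge0.
  rewrite expr2 {1}/pseries /series/= mulr_suml.
  rewrite [leRHS](@big_cat_nat _ _ _ n)//= ?leq_addr//.
  rewrite -[leLHS]addr0; apply: lerD; last first.
    by rewrite sumr_ge0// => k _; rewrite sumr_ge0// => l _; rewrite mulr_ge0.
  rewrite !big_nat; apply: ler_sum => k /andP[_ kn].
  rewrite -mulr_sumr ler_wpM2l//; apply: (conv_pseries_nd s s0).
  by rewrite -addnBA ?leq_addr// ltnW.
have sq_cvg : (fun n => pseries c s n ^+ 2) @ \oo --> limn (pseries c s) ^+ 2.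
  by under eq_fun do rewrite expr2; rewrite expr2; exact: cvgM.
have cd : cvgn (pseries d s).
  apply: nondecreasing_is_cvgn => //; exists (limn (pseries c s) ^+ 2).
  move=> _ [n _ <-]; apply: le_trans (le_sq n) _.
  rewrite lerXn2r ?nnegrE ?conv_pseries_ge0//; last first.
    by apply: nondecreasing_cvgn_le => //; exact: conv_pseries_nd.
  apply: le_trans (conv_pseries_ge0 s 0 s0) _.
  by apply: nondecreasing_cvgn_le => //; exact: conv_pseries_nd.
suff -> : limn (pseries c s) ^+ 2 = limn (pseries d s) by [].
apply/eqP; rewrite eq_le; apply/andP; split.
  rewrite -(cvg_lim _ sq_cvg)//; apply: limr_le.
    by apply/cvg_ex; eexists; exact: sq_cvg.
  apply: nearW => n; apply: le_trans (sq_le n) _.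
  exact: nondecreasing_cvgn_le.
rewrite -(cvg_lim _ sq_cvg)//; apply: ler_lim => //.
  by apply/cvg_ex; eexists; exact: sq_cvg.
exact: nearW.
Qed.

End PowerSeriesBlowup.

(** * Termwise differentiation of power series in [t^alpha] *)

Section FractionalPowerSeries.
Context {R : realType}.

Definition pseries_cvg_below (rho : R) (p : nat -> R) :=
  forall s, 0 <= s < rho -> cvgn (pseries p s).

(** This trades the factor [n] produced by differentiation for a slightly larger radius; it reflects
    that [r^n - s^n] is at least [(r - s) n s^(n-1)]. *)
Lemma natrX_le (r s : R) (n : nat) : 0 <= s -> s <= r ->
  n%:R * s ^+ n * (r - s) <= s * r ^+ n.
Proof.
move=> s0 sr; elim: n => [|n IH]; first by rewrite !mul0r mulr_ge0.
have r0 : 0 <= r by exact: le_trans sr.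
have sn : s ^+ n <= r ^+ n by rewrite lerXn2r.
apply: (@le_trans _ _ (s * (s * r ^+ n) + s * r ^+ n * (r - s))); last first.
  by rewrite exprS le_eqVlt; apply/orP; left; apply/eqP; ring.
have -> : n.+1%:R * s ^+ n.+1 * (r - s) =
    s * (n%:R * s ^+ n * (r - s)) + s * s ^+ n * (r - s).
  by rewrite exprS -natr1; ring.
by rewrite lerD ?ler_wpM2l ?ler_wpM2r ?subr_ge0// ler_wpM2l.
Qed.

Lemma pseries_cvg_below_natr (rho : R) (p : nat -> R) :
  pseries_cvg_below rho p ->
  pseries_cvg_below rho (fun n => n%:R * p n).
Proof.
move=> cp s /andP[s0 srho].
(* Two radii are inserted: convergence at [r'] gives absolute convergence at [r], and the gap
   [r - s] absorbs the factor [n]. *)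
pose r := (s + rho) / 2; pose r' := (r + rho) / 2.
have [sr rr' r'rho] : [/\ s < r, r < r' & r' < rho].
  by rewrite /r' /r; split; lra.
have r0 : 0 < r by exact: le_lt_trans sr.
have cr' : cvgn (pseries p r') by apply: cp; lra.
have cr : cvgn (pseries (fun n => `|p n|) r).
  by apply: is_cvg_pseries_inside_norm cr' _; rewrite !ger0_norm//; lra.
apply: normed_cvg.
apply: (@series_le_cvg _ _ ((s / (r - s)) *: (fun n => `|p n| * r ^+ n))).
- by move=> n; exact: normr_ge0.
- move=> n; apply: mulr_ge0; first by rewrite divr_ge0// subr_ge0 ltW.
  by rewrite mulr_ge0 ?exprn_ge0 ?(ltW r0).
- move=> n /=; rewrite !normrM normr_nat normrX (ger0_norm s0).
  rewrite [leRHS](_ : _ = `|p n| * (s * r ^+ n) / (r - s)); last first.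
    by rewrite /GRing.scale/= /GRing.scale/=; ring.
  rewrite ler_pdivlMr ?subr_gt0//.
  have -> : n%:R * `|p n| * s ^+ n * (r - s) =
      `|p n| * (n%:R * s ^+ n * (r - s)) by ring.
  by rewrite ler_wpM2l// natrX_le// ltW.
- exact: is_cvg_seriesZ.
Qed.

(** The derivative is expressed by the Euler operator [s d/ds], which multiplies the [n]-th
    coefficient by [n] without shifting indices. This form survives the substitution
    [s = t^alpha]. *)
Lemma cvg_pseries_diffs (rho s : R) (p : nat -> R) :
  pseries_cvg_below rho p -> 0 < s < rho ->
  pseries (pseries_diffs p) s @ \oo -->
  s^-1 * limn (pseries (fun n => n%:R * p n) s).
Proof.
move=> cp /andP[s0 srho].
have -> : pseries (pseries_diffs p) s =
    (fun N => s^-1 * pseries (fun n => n%:R * p n) s N.+1).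
  apply/funext => N; rewrite /pseries /series/= big_nat_recl//= !mul0r add0r.
  rewrite mulr_sumr; apply: eq_bigr => n _; rewrite /pseries_diffs exprS.
  by rewrite [RHS]mulrCA mulKf ?gt_eqF.
apply: cvgM; first exact: cvg_cst.
rewrite (cvg_shiftS (pseries _ s)).
by apply: (pseries_cvg_below_natr _ _ cp); rewrite ltW.
Qed.

Lemma pseries_cvg_below_diffs (rho : R) (p : nat -> R) :
  pseries_cvg_below rho p -> pseries_cvg_below rho (pseries_diffs p).
Proof.
(* The detour through [r > 0] covers [s = 0], where the formula with [s^-1] does not apply. *)
move=> cp s /andP[s0 srho]; pose r := (s + rho) / 2.
apply: (@is_cvg_pseries_inside _ _ r); last by rewrite !ger0_norm /r; lra.
by apply/cvg_ex; eexists; apply: cvg_pseries_diffs cp _; rewrite /r; lra.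
Qed.

Lemma is_derive_pseries_diffs (rho s : R) (p : nat -> R) :
  pseries_cvg_below rho p -> 0 <= s < rho ->
  is_derive s 1 (fun x => limn (pseries p x)) (limn (pseries (pseries_diffs p) s)).
Proof.
move=> cp s0rho; pose r := (s + rho) / 2.
have r0 : 0 <= r < rho by rewrite /r; lra.
apply: (@pseries_snd_diffs _ p r).
- exact: cp.
- exact: pseries_cvg_below_diffs cp _ _.
- exact: pseries_cvg_below_diffs (pseries_cvg_below_diffs _ _ cp) _ _.
- by rewrite !ger0_norm /r; lra.
Qed.

Lemma is_derive_pseries (rho s : R) (p : nat -> R) :
  pseries_cvg_below rho p -> 0 < s < rho ->
  is_derive s 1 (fun x => limn (pseries p x))
    (s^-1 * limn (pseries (fun n => n%:R * p n) s)).
Proof.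
move=> cp s0rho; rewrite -(cvg_lim _ (cvg_pseries_diffs _ _ _ cp s0rho))//.
by apply: is_derive_pseries_diffs cp _; lra.
Qed.

Lemma continuous_pseries (rho s : R) (p : nat -> R) :
  pseries_cvg_below rho p -> 0 <= s < rho ->
  {for s, continuous (fun x => limn (pseries p x))}.
Proof.
move=> cp s0rho; apply: differentiable_continuous; apply/derivable1_diffP.
by have [] := is_derive_pseries_diffs _ _ _ cp s0rho.
Qed.

Lemma cvg_pseries_affine (rho a b s : R) (p : nat -> R) :
  pseries_cvg_below rho p -> 0 <= s < rho ->
  pseries (fun n => (a * n%:R - b) * p n) s @ \oo -->
  a * limn (pseries (fun n => n%:R * p n) s) - b * limn (pseries p s).
Proof.
move=> cp s0rho.
have -> : pseries (fun n => (a * n%:R - b) * p n) s =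
    (fun N => a * pseries (fun n => n%:R * p n) s N - b * pseries p s N).
  apply/funext => N; rewrite /pseries /series/= !mulr_sumr -sumrB.
  by apply: eq_bigr => n _; ring.
apply: cvgB; apply: cvgM; try exact: cvg_cst.
  exact: pseries_cvg_below_natr cp _ _.
exact: cp.
Qed.

Variables (alpha rho : R) (c : nat -> R).

(* [frac_coef k] and [frac_fun k] encode the termwise k-th derivative of
   [sum_n c_n t^(alpha n)], namely [t^-k sum_n (alpha n)_k c_n t^(alpha n)]
   with the falling factorial [(alpha n)_k]. *)
Fixpoint frac_coef (k n : nat) : R :=
  if k is k'.+1 then (alpha * n%:R - k'%:R) * frac_coef k' n else c n.

Definition frac_fun (k : nat) (t : R) : R :=
  t `^ (- k%:R) * limn (pseries (frac_coef k) (t `^ alpha)).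

Hypothesis c_cvg : pseries_cvg_below rho c.

Lemma frac_coef_cvg (k : nat) : pseries_cvg_below rho (frac_coef k).
Proof.
elim: k => [//|k IH] s s0rho; apply/cvg_ex; eexists.
exact: (cvg_pseries_affine _ _ _ _ _ IH s0rho).
Qed.

(** The factor [t^-k] contributes [- k] and the chain rule contributes [alpha n] to the [n]-th term,
    both with one more power of [t^-1]; their sum is the new factor of the falling factorial. *)
Lemma is_derive_frac_fun (k : nat) (t : R) : 0 < t -> t `^ alpha < rho ->
  is_derive t 1 (frac_fun k) (frac_fun k.+1 t).
Proof.
move=> t0 trho; have ta0 : 0 < t `^ alpha by exact: powR_gt0.
have dk := is_derive1_powR (- k%:R) t0.
have da := is_derive1_powR alpha t0.
have dF := is_derive_pseries _ _ _ (frac_coef_cvg k)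
  (ltac:(apply/andP; split; [exact: ta0|exact: trho])
   : 0 < t `^ alpha < rho).
have dFa := @is_derive1_comp _ (fun x => limn (pseries (frac_coef k) x))
  (@powR R ^~ alpha) t _ _ dF da.
have := is_deriveM dk dFa.
congr (is_derive _ _ _ _).
rewrite /frac_fun /GRing.scale/=.
rewrite (cvg_lim _ (cvg_pseries_affine rho alpha k%:R (t `^ alpha) _
  (frac_coef_cvg k) _))//; last by rewrite ltW.
have -> : - k.+1%:R = - k%:R - 1 :> R by rewrite -natr1 opprD.
rewrite !powRB ?(gt_eqF t0) ?implybT// !powRr1 ?(ltW t0)//.
by field; rewrite !gt_eqF.
Qed.

End FractionalPowerSeries.

(** * Integrals with endpoint singularities: scaling, Beta and Gamma integrals *)

Section SingularIntegrals.
Context {R : realType}.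
Notation mu := (@lebesgue_measure R).

Lemma lebesgue_measure_scale (k : R) (A : set R) : 0 < k -> measurable A ->
  lebesgue_measure A =
  (k%:E * pushforward lebesgue_measure
            ( *%R k : measurableTypeR R -> measurableTypeR R) A)%E.
Proof.
move=> k0 mA.
have mk : measurable_fun setT ( *%R k : measurableTypeR R -> measurableTypeR R).
  exact: mulrl_measurable.
pose k' := NngNum (ltW k0).
pose f : {mfun measurableTypeR R >-> measurableTypeR R} :=
  HB.pack ( *%R k) (isMeasurableFun.Build _ _ _ _ _ mk).
apply: (@lebesgue_measure_unique R (mscale k' (pushforward mu f))) => //.
move=> _ [[a b]] _ <-; rewrite /mscale/= /pushforward/=.
rewrite [X in _ = (_ * mu X)%E](_ : _ = `](a / k), (b / k)]%classic); last first.
  apply/seteqP; split => x /=; rewrite !in_itv/= ltr_pdivrMr// ler_pdivlMr//;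
  by rewrite ![_ * k]mulrC.
rewrite !lebesgue_measure_itv/= !lte_fin ltr_pM2r ?invr_gt0//.
case: ifP => ab; last by rewrite mule0.
by rewrite -EFinM -mulrBl mulrCA divff ?gt_eqF// mulr1.
Qed.

Lemma ge0_integral_scale (k : R) (f : R -> \bar R) : 0 < k ->
  measurable_fun `]0, k[ f -> (forall x, 0 < x < k -> (0 <= f x)%E) ->
  (\int[mu]_(x in `]0%R, k[) f x =
   k%:E * \int[mu]_(x in `]0%R, 1%R[) f (k * x)%R)%E.
Proof.
move=> k0 mf f0.
have mk : measurable_fun setT ( *%R k : measurableTypeR R -> measurableTypeR R).
  exact: mulrl_measurable.
pose k' := NngNum (ltW k0).
pose g : {mfun measurableTypeR R >-> measurableTypeR R} :=
  HB.pack ( *%R k) (isMeasurableFun.Build _ _ _ _ _ mk).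
rewrite (@eq_measure_integral _ _ _ _ (mscale k' (pushforward mu g))); last first.
  by move=> A mA _; exact: lebesgue_measure_scale.
rewrite ge0_integral_mscale//.
rewrite ge0_integral_pushforward//; last first.
  by move=> x; rewrite inE/= in_itv/=; exact: f0.
congr (_ * _)%E; rewrite (_ : _ @^-1` _ = `]0, 1[%classic)//.
apply/seteqP; split => x /=; rewrite !in_itv/= pmulr_rgt0// gtr_pMr//.
Qed.

(** Neither [f] nor [F] is controlled at the endpoints, so the fundamental theorem is applied on
    compact subintervals, which exhaust []a, b[] by monotone convergence. *)
Lemma ge0_integral_oo_bound (f F : R -> R) (a b M : R) : a < b ->
  (forall x, a < x < b -> 0 <= f x) ->
  (forall x, a < x < b -> {for x, continuous f}) ->
  (forall x, a < x < b -> is_derive x 1 F (f x)) ->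
  (forall x y, a < x -> x <= y -> y < b -> F y - F x <= M) ->
  (\int[mu]_(x in `]a, b[) (f x)%:E <= M%:E)%E.
Proof.
move=> ab f0 cf dF bM.
(* The divisor is at least 3, so that even the first subinterval has positive length. *)
pose h n : R := (b - a) / n.+3%:R.
have h0 n : 0 < h n by rewrite divr_gt0// subr_gt0.
have hn n : h n < (b - a) / 2.
  by rewrite ltr_pM2l ?subr_gt0// ltf_pV2 ?posrE// ltr_nat.
pose I n : set R := `[a + h n, b - h n]%classic.
have Iab n x : I n x -> a < x < b.
  rewrite /I/= in_itv/= => /andP[ax xb].
  by rewrite (lt_le_trans _ ax) ?(le_lt_trans xb)//; have := h0 n; lra.
have mfab : measurable_fun `]a, b[ f.
  apply: open_continuous_measurable_fun; first exact: interval_open.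
  by move=> x; rewrite inE/= in_itv/=; exact: cf.
have -> : `]a, b[%classic = \bigcup_n I n.
  apply/seteqP; split => [x|x [n _ /Iab]]; rewrite /= in_itv//= => /andP[ax xb].
  have d0 : 0 < Num.min (x - a) (b - x) by rewrite lt_min !subr_gt0 ax xb.
  have hc : h @ \oo --> 0.
    rewrite -[X in _ --> X](mulr0 (b - a)); apply: cvgM; first exact: cvg_cst.
    have := @cvg_harmonic R; rewrite -(cvg_shiftn 2)/=.
    by under eq_cvg do rewrite addn2.
  have [n _ /(_ n (leqnn _))/=] := cvgr_lt _ hc _ d0.
  rewrite lt_min => /andP[h1 h2].
  by exists n => //; rewrite /I/= in_itv/=; lra.
have FTC n : (\int[mu]_(x in I n) (f x)%:E <= M%:E)%E.
  have hab : a + h n < b - h n by have := hn n; lra.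
  rewrite /I (@continuous_FTC2 _ f F _ _ hab).
  - rewrite -EFinB lee_fin; apply: bM; have := h0 n; lra.
  - apply: continuous_in_subspaceT => x; rewrite inE => /Iab; exact: cf.
  - have cF x : a < x < b -> {for x, continuous F}.
      by move=> /dF [dx _]; apply: differentiable_continuous; exact/derivable1_diffP.
    split.
    + move=> x; rewrite in_itv/= => /andP[ax xb].
      by have [] := dF x; rewrite // (lt_trans _ ax) ?(lt_trans xb)//; have := h0 n; lra.
    + by apply: cvg_at_right_filter; apply: cF; have := h0 n; lra.
    + by apply: cvg_at_left_filter; apply: cF; have := h0 n; lra.
  - move=> x; rewrite in_itv/= => /andP[ax xb]; rewrite derive1E.
    have xab : a < x < b by have := h0 n; lra.
    by have [_ ->] := dF _ xab.
have mI n : measurable_fun (I n) (EFin \o f).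
  apply/measurable_EFinP; apply: measurable_funS mfab => //.
  by move=> x /Iab; rewrite /= in_itv.
have : (\int[mu]_(x in I n) (f x)%:E @[n --> \oo] -->
    \int[mu]_(x in \bigcup_n I n) (f x)%:E)%E.
  apply: ge0_nondecreasing_set_cvg_integral => //.
  - apply/nondecreasing_seqP => n; rewrite subsetEset => x.
    rewrite /I/= !in_itv/=.
    have : h n.+1 <= h n by rewrite ler_pM2l ?subr_gt0// lef_pV2 ?posrE// ler_nat.
    lra.
  - by move=> n; exact: measurable_itv.
  - by move=> n x /Iab/f0; rewrite lee_fin.
move=> cI; rewrite -(cvg_lim _ cI)//; apply: lime_le.
  by apply/cvg_ex; eexists; exact: cI.
exact: nearW.
Qed.

Lemma continuous_powR_gt0 (g x : R) : 0 < x -> {for x, continuous (@powR R ^~ g)}.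
Proof.
move=> x0; apply: differentiable_continuous; apply/derivable1_diffP.
by have [] := @is_derive1_powR R g x x0.
Qed.

Lemma integral_powR01_lty (g : R) : 0 < g ->
  (\int[mu]_(x in `]0%R, 1%R[) (x `^ (g - 1))%:E < +oo)%E.
Proof.
move=> g0; apply: (@le_lt_trans _ _ (g^-1)%:E); last exact: ltry.
apply: (@ge0_integral_oo_bound _ (fun x => g^-1 * x `^ g)) => //.
- by move=> x _; exact: powR_ge0.
- by move=> x /andP[x0 _]; exact: continuous_powR_gt0.
- move=> x /andP[x0 _]; have h := @is_derive1_powR R g x x0.
  have := is_deriveZ g^-1 h.
  by rewrite /GRing.scale/= mulrA mulVf ?gt_eqF// mul1r.
- move=> x y x0 xy y1.
  have yg : y `^ g <= 1 `^ g.
    apply: ge0_ler_powR; rewrite ?nnegrE; lra.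
  rewrite powR1 in yg.
  have xg := powR_ge0 x g.
  by rewrite -mulrBr -[leRHS]mulr1 ler_pM2l ?invr_gt0//; lra.
Qed.

Lemma integral_powR01B_lty (g : R) : 0 < g ->
  (\int[mu]_(x in `]0%R, 1%R[) ((1 - x) `^ (g - 1))%:E < +oo)%E.
Proof.
move=> g0; apply: (@le_lt_trans _ _ (g^-1)%:E); last exact: ltry.
apply: (@ge0_integral_oo_bound _ (fun x => - g^-1 * (1 - x) `^ g)) => //.
- by move=> x _; exact: powR_ge0.
- move=> x /andP[_ x1].
  apply: (@cvg_comp _ _ _ (fun x : R => 1 - x) (@powR R ^~ (g - 1)) _
    (nbhs (1 - x))).
    by apply: cvgB; [exact: cvg_cst|exact: cvg_id].
  by apply: continuous_powR_gt0; rewrite subr_gt0.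
- move=> x /andP[_ x1]; have x10 : 0 < 1 - x by rewrite subr_gt0.
  have h := @is_derive1_powR R g _ x10.
  have d1 : is_derive x 1 (fun x : R => 1 - x) (-1).
    by apply: is_derive_eq; lra.
  have h2 := @is_derive1_comp _ (@powR R ^~ g) (fun y : R => 1 - y) x _ _ h d1.
  have := is_deriveZ (- g^-1) h2.
  rewrite /GRing.scale/=; congr (is_derive _ _ _ _).
  by rewrite mulrN1 mulrNN mulrA mulVf ?gt_eqF// mul1r.
- move=> x y x0 xy y1.
  have xg : (1 - x) `^ g <= 1 `^ g.
    apply: ge0_ler_powR; rewrite ?nnegrE; lra.
  rewrite powR1 in xg.
  have yg := powR_ge0 (1 - y) g.
  by rewrite !mulNr opprK addrC -mulrBr -[leRHS]mulr1 ler_pM2l ?invr_gt0//; lra.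
Qed.

Section CaputoBeta.
Variables (alpha : R) (alpha01 : 0 < alpha < 1).

Definition caputo_beta_fun (g x : R) : R := x `^ (g - 1) / (1 - x) `^ alpha.

(** This is the Beta value [B(g, 1 - alpha)]. *)
Definition caputo_beta (g : R) : R :=
  \int[mu]_(x in `]0, 1[) caputo_beta_fun g x.

Lemma caputo_beta_fun_ge0 (g x : R) : 0 <= caputo_beta_fun g x.
Proof. by rewrite divr_ge0 ?powR_ge0. Qed.

Lemma measurable_powR_conv (g t : R) (D : set R) :
  measurable_fun D (fun x : R => x `^ (g - 1) / (t - x) `^ alpha).
Proof.
apply: measurable_funTS; apply: measurable_funM; first exact: measurable_powR.
have -> : (fun x : R => ((t - x) `^ alpha)^-1) = (fun x => (t - x) `^ (- alpha)).
  by apply/funext => x; rewrite powRN.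
apply: (measurableT_comp (measurable_powR (- alpha)) (g := fun x : R => t - x)).
by apply: measurable_funB => //; exact: measurable_cst.
Qed.

(** On each half of []0, 1[] the factor that is singular at the far end is at most 2, so the
    integrand is dominated by a sum of two powers with one singularity each. *)
Lemma caputo_beta_lty (g : R) : 0 < g ->
  (\int[mu]_(x in `]0%R, 1%R[) (caputo_beta_fun g x)%:E < +oo)%E.
Proof.
move=> g0; case/andP: alpha01 => a0 a1.
have a10 : 0 < 1 - alpha by rewrite subr_gt0.
have m2 (h : R -> R) (D : set R) : measurable_fun D h ->
    measurable_fun D (fun x => 2 * h x).
  by move=> mh; apply: measurable_funM => //; exact: measurable_cst.
pose p x : R := x `^ (g - 1); pose q x : R := (1 - x) `^ (1 - alpha - 1).
have mp (D : set R) : measurable_fun D p.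
  apply: measurable_funTS; exact: measurable_powR.
have mq (D : set R) : measurable_fun D q.
  apply: measurable_funTS.
  apply: (measurableT_comp (measurable_powR (1 - alpha - 1)) (g := fun x : R => 1 - x)).
  by apply: measurable_funB => //; exact: measurable_cst.
apply: (@le_lt_trans _ _
    (\int[mu]_(x in `]0%R, 1%R[) ((2 * p x)%:E + (2 * q x)%:E))%E).
  apply: ge0_le_integral => //.
  - by move=> x _; rewrite lee_fin caputo_beta_fun_ge0.
  - by apply/measurable_EFinP; exact: measurable_powR_conv.
  - by apply: emeasurable_funD; apply/measurable_EFinP; apply: m2.
  move=> x; rewrite /= in_itv/= => /andP[x0 x1].
  rewrite -EFinD lee_fin /caputo_beta_fun -powRN.
  have -> : - alpha = 1 - alpha - 1 by ring.
  rewrite -/(p x) -/(q x).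
  have p0 : 0 <= p x by exact: powR_ge0.
  have q0 : 0 <= q x by exact: powR_ge0.
  have le2 y r : 2^-1 <= y -> y <= 1 -> - 1 <= r -> y `^ r <= 2.
    move=> y2 y1 r1; have y0 : 0 < y by lra.
    apply: (@le_trans _ _ (y `^ (-1))); first by apply: ger_powR; rewrite ?y0.
    by rewrite powR_inv1 ?(ltW y0)// invf_ple// ?posrE.
  have [x2|x2] := leP x 2^-1.
    have : q x <= 2 by apply: le2; lra.
    by move=> q2; rewrite ler_wpDr ?mulr_ge0// mulrC ler_wpM2r.
  have : p x <= 2 by apply: le2; lra.
  by move=> p2; rewrite ler_wpDl ?mulr_ge0// ler_wpM2r.
rewrite ge0_integralD//; last first.
- by apply/measurable_EFinP; exact: m2.
- by move=> x _; rewrite lee_fin mulr_ge0// powR_ge0.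
- by apply/measurable_EFinP; exact: m2.
- by move=> x _; rewrite lee_fin mulr_ge0// powR_ge0.
have Z2 (h : R -> R) : (forall D : set R, measurable_fun D h) ->
    (forall x, 0 <= h x) ->
    (\int[mu]_(x in `]0%R, 1%R[) (2 * h x)%:E =
     2%:E * \int[mu]_(x in `]0%R, 1%R[) (h x)%:E)%E.
  move=> mh h0; under eq_integral do rewrite EFinM.
  rewrite ge0_integralZl_EFin//; last by apply/measurable_EFinP; exact: mh.
  by move=> x _; rewrite lee_fin h0.
rewrite (Z2 p mp) ?(Z2 q mq); try by move=> x; exact: powR_ge0.
apply: lte_add_pinfty; apply: lte_mul_pinfty => //.
- exact: integral_powR01_lty.
- exact: integral_powR01B_lty.
Qed.

Lemma EFin_caputo_beta (g : R) : 0 < g ->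
  (\int[mu]_(x in `]0%R, 1%R[) (caputo_beta_fun g x)%:E = (caputo_beta g)%:E)%E.
Proof.
move=> g0; rewrite /caputo_beta /Rintegral fineK// ge0_fin_numE ?caputo_beta_lty//.
by apply: integral_ge0 => x _; rewrite lee_fin caputo_beta_fun_ge0.
Qed.

Lemma caputo_beta_le (g g' : R) : 0 < g -> g <= g' ->
  caputo_beta g' <= caputo_beta g.
Proof.
move=> g0 gg'; rewrite -lee_fin -!EFin_caputo_beta//; last exact: lt_le_trans gg'.
apply: ge0_le_integral => //.
- by move=> x _; rewrite lee_fin caputo_beta_fun_ge0.
- by apply/measurable_EFinP; exact: measurable_powR_conv.
- by apply/measurable_EFinP; exact: measurable_powR_conv.
move=> x; rewrite /= in_itv/= => /andP[x0 x1]; rewrite lee_fin.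
rewrite ler_wpM2r ?invr_ge0 ?powR_ge0//.
by apply: ger_powR; rewrite ?x0 ?(ltW x1)// lerB.
Qed.

(* On [1 - h, 1] the kernel is at least [h^-alpha], while [g * x^(g - 1)]
   concentrates its unit mass near 1 as [g] grows. *)
Lemma caputo_beta_ge (g h : R) : 0 < g -> 0 < h < 1 ->
  (1 - (1 - h) `^ g) / h `^ alpha <= g * caputo_beta g.
Proof.
move=> g0 /andP[h0 h1]; case/andP: alpha01 => a0 a1.
have h1' : 1 - h < 1 by lra.
have pos (x : R) : 1 - h <= x -> 0 < x by lra.
have dP (x : R) : 0 < x -> is_derive x 1 (fun y => g^-1 * y `^ g) (x `^ (g - 1)).
  move=> x0; have h' := @is_derive1_powR R g _ x0.
  have := is_deriveZ g^-1 h'.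
  by rewrite /GRing.scale/= mulrA mulVf ?gt_eqF// mul1r.
have cP (x : R) : 0 < x -> {for x, continuous (fun y : R => g^-1 * y `^ g)}.
  by move=> /dP[dx _]; apply: differentiable_continuous; exact/derivable1_diffP.
have FTC : (\int[mu]_(x in `[(1 - h)%R, 1%R]) (x `^ (g - 1))%:E =
    (g^-1 * (1 - (1 - h) `^ g))%:E)%E.
  rewrite (@continuous_FTC2 _ _ (fun y => g^-1 * y `^ g))//.
  - by rewrite -EFinB powR1 mulrBr.
  - apply: continuous_in_subspaceT => x; rewrite inE/= in_itv/= => /andP[/pos x0 _].
    exact: continuous_powR_gt0.
  - split.
    + by move=> x; rewrite in_itv/= => /andP[/ltW/pos/dP[]].
    + by apply: cvg_at_right_filter; apply: cP; lra.
    + by apply: cvg_at_left_filter; apply: cP; lra.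
  - by move=> x; rewrite in_itv/= derive1E => /andP[/ltW/pos/dP[_ ->]].
have mpow (D : set R) : measurable_fun D (fun x : R => x `^ (g - 1)).
  by apply: measurable_funTS; exact: measurable_powR.
suff : (((1 - (1 - h) `^ g) / h `^ alpha * g^-1)%:E <= (caputo_beta g)%:E)%E.
  by rewrite lee_fin ler_pdivrMr// [caputo_beta g * g]mulrC.
have -> : (1 - (1 - h) `^ g) / h `^ alpha * g^-1 =
   (h `^ alpha)^-1 * (g^-1 * (1 - (1 - h) `^ g)) by ring.
rewrite EFinM -FTC -EFin_caputo_beta// -integral_itv_bndo_bndc; last first.
  by apply/measurable_EFinP; exact: mpow.
rewrite -ge0_integralZl_EFin//; last 3 first.
- by move=> x _; rewrite lee_fin powR_ge0.
- by apply/measurable_EFinP; exact: mpow.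
- by rewrite invr_ge0 powR_ge0.
apply: (@le_trans _ _ (\int[mu]_(x in `[(1 - h)%R, 1%R[)
    (caputo_beta_fun g x)%:E)%E).
  apply: ge0_le_integral => //.
  - by move=> x _; rewrite -EFinM lee_fin mulr_ge0 ?invr_ge0 ?powR_ge0.
  - apply/measurable_EFinP; apply: measurable_funM; first exact: measurable_cst.
    exact: mpow.
  - by apply/measurable_EFinP; exact: measurable_powR_conv.
  move=> x; rewrite /= in_itv/= => /andP[x0 x1]; rewrite -EFinM lee_fin mulrC.
  rewrite ler_wpM2l ?powR_ge0// lef_pV2 ?posrE ?powR_gt0//; last lra.
  by apply: ge0_ler_powR; rewrite ?nnegrE; lra.
apply: ge0_subset_integral => //.
- by apply/measurable_EFinP; exact: measurable_powR_conv.
- by move=> x _; rewrite lee_fin caputo_beta_fun_ge0.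
- by move=> x /=; rewrite !in_itv/=; lra.
Qed.

(** In [caputo_beta_ge], [h] is fixed first, so small that [h^-alpha >= L]; then [g] is taken so
    large that [(1 - h)^g <= 1/2]. This leaves at least [L / 2 = |M| + 1]. *)
Lemma caputo_beta_cvgy : g * caputo_beta g @[g --> +oo] --> +oo.
Proof.
case/andP: alpha01 => a0 a1.
apply/cvgryPge => M.
pose L := 2 * (`|M| + 1).
have L0 : 0 < L by rewrite mulr_gt0// ltr_wpDl.
pose h := Num.min 2^-1 (L^-1 `^ alpha^-1).
have h0 : 0 < h by rewrite lt_min invr_gt0 ltr0n powR_gt0// invr_gt0.
have h2 : h <= 2^-1 by rewrite ge_min lexx.
have hL : h `^ alpha <= L^-1.
  have -> : L^-1 = (L^-1 `^ alpha^-1) `^ alpha.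
    by rewrite -powRrM mulVf ?gt_eqF// powRr1// invr_ge0 ltW.
  apply: ge0_ler_powR; rewrite ?nnegrE ?powR_ge0 ?(ltW h0) ?(ltW a0)//.
  by rewrite ge_min lexx orbT.
have [n _ /(_ n (leqnn _))/= hn] : \forall n \near \oo, (1 - h) ^+ n < 2^-1.
  have : `|1 - h| < 1 by rewrite ger0_norm; lra.
  by move=> /cvg_expr/(cvgr_lt _)/(_ 2^-1); apply; rewrite invr_gt0.
near=> g.
have g0 : 0 < g by near: g; exact: nbhs_pinfty_gt.
have ng : n%:R <= g by near: g; exact: nbhs_pinfty_ge.
apply: le_trans (caputo_beta_ge g h g0 _); last by lra.
have : (1 - h) `^ g <= 2^-1.
  apply: le_trans (ltW hn); rewrite -powR_mulrn; last lra.
  by apply: ger_powR => //; lra.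
move=> hg; apply: (@le_trans _ _ (2^-1 * L)).
  by rewrite /L mulrA mulVf// mul1r; have := ler_norm M; lra.
apply: ler_pM => //; [exact: ltW|lra|].
by rewrite -[leLHS]invrK lef_pV2// posrE ?invr_gt0// powR_gt0.
Unshelve. all: by end_near. Qed.

(** Divergence of [g * caputo_beta g] gives positivity at large arguments, and [caputo_beta] is
    nonincreasing. *)
Lemma caputo_beta_gt0 (g : R) : 0 < g -> 0 < caputo_beta g.
Proof.
move=> g0; have := caputo_beta_cvgy; move=> /cvgryPgt /(_ 0) h.
near (+oo : set_system R) => g'.
have : 0 < g' * caputo_beta g' by near: g'.
have gg' : g <= g' by near: g'; apply: nbhs_pinfty_ge; rewrite num_real.
rewrite pmulr_rgt0; last exact: lt_le_trans gg'.
by move=> /lt_le_trans; apply; exact: caputo_beta_le.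
Unshelve. all: by end_near. Qed.

(** The substitution [x = t y] pulls out [t * t^(g - 1) / t^alpha]. Up to the factor
    [g / Gamma (1 - alpha)] this is the Caputo derivative of [t^g]. *)
Lemma integral_powR_conv (g t : R) : 0 < g -> 0 < t ->
  (\int[mu]_(x in `]0%R, t[) (x `^ (g - 1) / (t - x) `^ alpha)%:E =
   (t `^ (g - alpha) * caputo_beta g)%:E)%E.
Proof.
move=> g0 t0; rewrite ge0_integral_scale//; last first.
- by move=> x _; rewrite lee_fin divr_ge0 ?powR_ge0.
- by apply/measurable_EFinP; exact: measurable_powR_conv.
rewrite (@eq_integral _ _ _ mu _
  (fun x => ((t `^ (g - 1) / t `^ alpha)%:E * (caputo_beta_fun g x)%:E)%E)); last first.
  move=> x; rewrite inE/= in_itv/= => /andP[x0 x1].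
  rewrite -EFinM; congr EFin; rewrite /caputo_beta_fun.
  have -> : t - t * x = t * (1 - x) by ring.
  by rewrite !powRM; [rewrite invfM mulrACA|lra..].
rewrite ge0_integralZl_EFin//; last first.
- by rewrite divr_ge0 ?powR_ge0.
- by apply/measurable_EFinP; exact: measurable_powR_conv.
- by move=> x _; rewrite lee_fin caputo_beta_fun_ge0.
rewrite EFin_caputo_beta// -!EFinM !mulrA; congr ((_ * _)%:E).
rewrite mulr_powRB1 ?(ltW t0)// powRB//.
by rewrite (gt_eqF t0) implybT.
Qed.

End CaputoBeta.

(** A divergent integral would have real value 0, so finiteness must be proved along with a positive
    lower bound. The integrand is dominated by [r^(s - 1)] below 1 and, since [s <= 1], by
    [expR (- r)] above. *)
Lemma Gamma_gt0 (s : R) : 0 < s <= 1 -> 0 < Gamma s.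
Proof.
move=> /andP[s0 s1].
pose f r : R := r `^ (s - 1) * expR (- r).
have f0 r : 0 <= f r by rewrite mulr_ge0 ?powR_ge0 ?expR_ge0.
have mexp (D : set R) : measurable_fun D (fun r : R => expR (- r)).
  apply: measurable_funTS; apply: (measurableT_comp (@measurable_expR R)).
  exact: oppr_measurable.
have mpow (D : set R) : measurable_fun D (fun r : R => r `^ (s - 1)).
  by apply: measurable_funTS; exact: measurable_powR.
have mf (D : set R) : measurable_fun D f by apply: measurable_funM.
rewrite /Gamma /Rintegral -/f; apply: fine_gt0; apply/andP; split.
  apply: (@lt_le_trans _ _ (\int[mu]_(r in `]0%R, 1%R[) (expR (- 1))%:E)%E).
    rewrite integral_cst//= lebesgue_measure_itv/= lte_fin ltr01.
    by rewrite -EFinB -EFinM lte_fin subr0 mulr1 expR_gt0.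
  apply: (@le_trans _ _ (\int[mu]_(r in `]0%R, 1%R[) (f r)%:E)%E).
    apply: ge0_le_integral => //.
    - by apply/measurable_EFinP; first [exact: mf|exact: mexp|exact: mpow].
    move=> r; rewrite /= in_itv/= => /andP[r0 r1]; rewrite lee_fin.
    rewrite -[leLHS]mul1r; apply: ler_pM => //; rewrite ?expR_ge0//.
      have : r `^ 0 <= r `^ (s - 1) by apply: ger_powR; rewrite ?r0 ?(ltW r1)//; lra.
      by rewrite powRr0.
    by rewrite ler_expR lerN2 ltW.
  apply: ge0_subset_integral => //.
  - by apply/measurable_EFinP; first [exact: mf|exact: mexp|exact: mpow].
  - by move=> r _; rewrite lee_fin; exact: f0.
  - by move=> r; rewrite /= !in_itv/= => /andP[->].
have -> : `]0, +oo[%classic = `]0%R, 1%R[%classic `|` `[1%R, +oo[%classic :> set R.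
  apply/seteqP; split => r; rewrite /= !in_itv/= ?andbT.
    by move=> r0; have [r1|r1] := ltP r 1; [left; rewrite r0|right].
  by case; lra.
rewrite ge0_integral_setU//; last first.
- apply/disj_setPS => r [] /=; rewrite !in_itv/=; lra.
- by move=> r _; rewrite lee_fin; exact: f0.
- by apply/measurable_EFinP; first [exact: mf|exact: mexp|exact: mpow].
apply: lte_add_pinfty.
  apply: le_lt_trans (integral_powR01_lty s s0).
  apply: ge0_le_integral => //.
  - by move=> r _; rewrite lee_fin; exact: f0.
  - by apply/measurable_EFinP; first [exact: mf|exact: mexp|exact: mpow].
  - by apply/measurable_EFinP; first [exact: mf|exact: mexp|exact: mpow].
  move=> r; rewrite /= in_itv/= => /andP[r0 r1]; rewrite lee_fin.
  rewrite -[leRHS]mulr1 ler_wpM2l ?powR_ge0//.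
  by rewrite -expR0 ler_expR oppr_le0 ltW.
apply: (@le_lt_trans _ _ (\int[mu]_(r in `[1%R, +oo[) (expR (- r))%:E)%E).
  apply: ge0_le_integral => //.
  - by move=> r _; rewrite lee_fin; exact: f0.
  - by apply/measurable_EFinP; first [exact: mf|exact: mexp|exact: mpow].
  - by apply/measurable_EFinP; first [exact: mf|exact: mexp|exact: mpow].
  move=> r; rewrite /= in_itv/= andbT => r1; rewrite lee_fin.
  rewrite -[leRHS]mul1r ler_wpM2r ?expR_ge0//.
  have : r `^ (s - 1) <= r `^ 0 by apply: ler_powR => //; lra.
  by rewrite powRr0.
have dE (x : R) : is_derive x 1 (fun r : R => - expR (- r)) (expR (- x)).
  by apply: is_derive_eq; rewrite /GRing.scale/=; ring.
have cE : {for 1, continuous (fun r : R => - expR (- r))}.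
  by apply: differentiable_continuous; apply/derivable1_diffP; have [] := dE 1.
rewrite (@ge0_continuous_FTC2y _ (fun r => expR (- r)) (fun r => - expR (- r)) 1 0).
- by rewrite -EFinB ltry.
- by move=> r _; exact: expR_ge0.
- apply: continuous_subspaceT => x.
  by apply: (@cvg_comp _ _ _ (@GRing.opp R) expR _ (nbhs (- x)));
    [exact: opp_continuous|exact: continuous_expR].
- rewrite -[X in _ --> X]oppr0; apply: cvgN; exact: cvgr_expR.
- by move=> r _; have [] := dE r.
- exact: cvg_at_right_filter.
- by move=> r _; rewrite derive1E; have [_ ->] := dE r.
Qed.

End SingularIntegrals.

(** * Construction of the coefficients by course-of-values recursion *)

Section ConvolutionRecursion.
Context {R : fieldType}.
Variable a : nat -> R.

(** The next coefficient needs all earlier ones, so the recursion carries their list; appending on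
    the right keeps the index of each entry fixed. *)
Fixpoint conv_coefs (n : nat) : seq R :=
  if n is n'.+1 then
    let s := conv_coefs n' in
    rcons s ((\sum_(0 <= k < n'.+1) s`_k * s`_(n' - k)) / a n')
  else [:: 1].

Definition conv_coef (n : nat) : R := (conv_coefs n)`_n.

Lemma size_conv_coefs (n : nat) : size (conv_coefs n) = n.+1.
Proof. by elim: n => //= n IH; rewrite size_rcons IH. Qed.

Lemma nth_conv_coefs (n k : nat) : (k <= n)%N -> (conv_coefs n)`_k = conv_coef k.
Proof.
elim: n => [|n IH]; first by rewrite leqn0 => /eqP->.
rewrite leq_eqVlt => /predU1P[->//|]; rewrite ltnS => kn.
by rewrite /= nth_rcons size_conv_coefs ltnS kn IH.
Qed.

Lemma conv_coefS (n : nat) : conv_coef n.+1 =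
  (\sum_(0 <= k < n.+1) conv_coef k * conv_coef (n - k)%N) / a n.
Proof.
rewrite {1}/conv_coef /= nth_rcons size_conv_coefs ltnn eqxx.
congr (_ / _); rewrite !big_nat; apply: eq_bigr => k /andP[_].
by rewrite ltnS => kn; rewrite !nth_conv_coefs// leq_subr.
Qed.

End ConvolutionRecursion.

(** * The fractional series solves the Caputo-Riccati equation *)

Section CaputoRiccati.
Context {R : realType}.
Notation mu := (@lebesgue_measure R).
Variables (alpha : R) (alpha01 : 0 < alpha < 1).

Let alpha_gt0 : 0 < alpha. Proof. by case/andP: alpha01. Qed.

Let Gamma1B_gt0 : 0 < Gamma (1 - alpha).
Proof. by apply: Gamma_gt0; case/andP: alpha01 => *; lra. Qed.

(* The Caputo derivative of [t^(alpha (n + 1))] is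
   [caputo_ratio n * t^(alpha n)]. *)
Definition caputo_ratio (n : nat) : R :=
  alpha * n.+1%:R * caputo_beta alpha (alpha * n.+1%:R) / Gamma (1 - alpha).

Let anS_gt0 (n : nat) : 0 < alpha * n.+1%:R.
Proof. by rewrite mulr_gt0. Qed.

Lemma caputo_ratio_gt0 (n : nat) : 0 < caputo_ratio n.
Proof. by apply/divr_gt0/Gamma1B_gt0/mulr_gt0 => //; exact: caputo_beta_gt0. Qed.

Lemma caputo_ratio_le (n : nat) : caputo_ratio n <=
  alpha * caputo_beta alpha alpha / Gamma (1 - alpha) * n.+1%:R.
Proof.
rewrite /caputo_ratio [leRHS]mulrAC ler_pM2r ?invr_gt0// [leRHS]mulrAC.
rewrite ler_pM2l//; apply: caputo_beta_le => //.
by rewrite ler_peMr ?(ltW alpha_gt0)// ler1n.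
Qed.

Lemma caputo_ratio_cvgy : caputo_ratio @ \oo --> +oo.
Proof.
apply/cvgryPge => M; rewrite /caputo_ratio.
have : (fun n : nat => alpha * n.+1%:R) @ \oo --> +oo.
  apply/cvgryPge => B; near=> n.
  rewrite -ler_pdivrMl// (@le_trans _ _ n%:R) ?ler_nat//.
  by near: n; exact: nbhs_infty_ger.
move=> /(cvg_comp _ _)/(_ (caputo_beta_cvgy alpha alpha01)).
move=> /cvgryPge/(_ (M * Gamma (1 - alpha)))h.
near=> n; rewrite ler_pdivlMr//.
by near: n.
Unshelve. all: by end_near. Qed.

Definition riccati_coef : nat -> R := conv_coef caputo_ratio.

Lemma riccati_coef_blowup : exists rho : R, [/\ 0 < rho,
  pseries_cvg_below rho riccati_coef &
  limn (pseries riccati_coef s) @[s --> rho^'-] --> +oo].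
Proof.
apply: (@conv_pseries_blowup _ caputo_ratio riccati_coef _ erefl _ _
  (alpha * caputo_beta alpha alpha / Gamma (1 - alpha))).
- exact: caputo_ratio_gt0.
- exact: conv_coefS.
- exact: caputo_ratio_cvgy.
- by rewrite divr_gt0// mulr_gt0// caputo_beta_gt0.
- exact: caputo_ratio_le.
Qed.

Variable rho : R.
Hypothesis coef_cvg : pseries_cvg_below rho riccati_coef.

Notation F := (fun s => limn (pseries riccati_coef s)).
Notation V := (frac_fun alpha riccati_coef).

Let coef_ge0 (n : nat) : 0 <= riccati_coef n.
Proof.
by apply: (conv_coef_ge0 caputo_ratio) => //;
  [exact: caputo_ratio_gt0|exact: conv_coefS].
Qed.

(** The constant term is killed by differentiation. Dropping it leaves exponents above -1, so each
    remaining term is integrable near 0 against the kernel. *)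
Lemma cvg_frac_fun1 (t : R) : 0 < t -> t `^ alpha < rho ->
  \sum_(0 <= n < N) alpha * n.+1%:R * riccati_coef n.+1 *
    t `^ (alpha * n.+1%:R - 1) @[N --> \oo] --> V 1%N t.
Proof.
move=> t0 trho.
have -> : (fun N => \sum_(0 <= n < N) alpha * n.+1%:R * riccati_coef n.+1 *
    t `^ (alpha * n.+1%:R - 1)) =
  (fun N => t `^ (- 1%:R) *
     pseries (frac_coef alpha riccati_coef 1) (t `^ alpha) N.+1).
  apply/funext => N; rewrite /pseries /series/= big_nat_recl//=.
  rewrite mulr0 subrr !mul0r add0r mulr_sumr; apply: eq_bigr => n _.
  rewrite subr0 powRD; last by rewrite (gt_eqF t0) implybT.
  by rewrite powRrM powR_mulrn ?powR_ge0//; ring.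
apply: cvgM; first exact: cvg_cst.
rewrite (cvg_shiftS (pseries _ _)).
by apply: (frac_coef_cvg alpha rho riccati_coef coef_cvg 1); rewrite powR_ge0.
Qed.

Lemma frac_fun1_ge0 (t : R) : 0 < t -> t `^ alpha < rho -> 0 <= V 1%N t.
Proof.
move=> t0 trho; have h := cvg_frac_fun1 _ t0 trho.
rewrite -(cvg_lim _ h)//; apply: limr_ge; first by apply/cvg_ex; eexists; exact: h.
apply: nearW => N; rewrite sumr_ge0// => n _.
by rewrite !mulr_ge0 ?powR_ge0 ?coef_ge0 ?(ltW alpha_gt0).
Qed.

Let lt_powR_rho (t x : R) : t `^ alpha < rho -> 0 < x < t -> x `^ alpha < rho.
Proof.
move=> trho /andP[x0 xt]; apply: le_lt_trans trho.
by apply: ge0_ler_powR; rewrite ?nnegrE; have := alpha_gt0; lra.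
Qed.

(** Nonnegative terms allow integration term by term. The Beta value from each term cancels the one
    in [caputo_ratio], which leaves the convolution of the coefficients, and these sum to the Cauchy
    square. As an identity in the extended reals it also yields integrability. *)
Lemma integral_frac_fun1 (t : R) : 0 < t -> t `^ alpha < rho ->
  (\int[mu]_(x in `]0%R, t[) (V 1%N x / (t - x) `^ alpha)%:E =
   (Gamma (1 - alpha) * F (t `^ alpha) ^+ 2)%:E)%E.
Proof.
move=> t0 trho.
pose b n := alpha * n.+1%:R * riccati_coef n.+1.
have b0 n : 0 <= b n by rewrite !mulr_ge0// ltW.
pose k n x : R := x `^ (alpha * n.+1%:R - 1) / (t - x) `^ alpha.
have k0 n x : 0 <= k n x by rewrite divr_ge0 ?powR_ge0.
have mk n (D : set R) : measurable_fun D (k n) by exact: measurable_powR_conv.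
transitivity (\int[mu]_(x in `]0%R, t[) (\sum_(n <oo) (b n * k n x)%:E))%E.
  apply: eq_integral => x; rewrite inE/= in_itv/= => /[dup] x0t /andP[x0 xt].
  have h := cvg_frac_fun1 _ x0 (lt_powR_rho _ _ trho x0t).
  apply/esym/cvg_lim => //.
  under eq_cvg do rewrite sumEFin.
  apply: cvg_EFin; first exact: nearW.
  have -> : fine \o (fun N => (\sum_(0 <= n < N) b n * k n x)%:E) =
    (fun N => (\sum_(0 <= n < N) b n * x `^ (alpha * n.+1%:R - 1)) *
              ((t - x) `^ alpha)^-1).
    by apply/funext => N /=; rewrite mulr_suml; apply: eq_bigr => n _; rewrite mulrA.
  by apply: cvgM; [exact: h|exact: cvg_cst].
rewrite integral_nneseries//; last 2 first.
- move=> n; apply/measurable_EFinP; apply: measurable_funM; first exact: measurable_cst.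
  exact: mk.
- by move=> n x _; rewrite lee_fin mulr_ge0.
have Ik n : (\int[mu]_(x in `]0%R, t[) (b n * k n x)%:E =
   (Gamma (1 - alpha) *
    ((\sum_(0 <= i < n.+1) riccati_coef i * riccati_coef (n - i)%N) *
    (t `^ alpha) ^+ n))%:E)%E.
  under eq_integral do rewrite EFinM.
  rewrite ge0_integralZl_EFin//; last 2 first.
  - by move=> x _; rewrite lee_fin.
  - by apply/measurable_EFinP; exact: mk.
  rewrite integral_powR_conv// -EFinM; congr EFin.
  have -> : t `^ (alpha * n.+1%:R - alpha) = (t `^ alpha) ^+ n.
    rewrite -powR_mulrn ?powR_ge0// -powRrM; congr (_ `^ _).
    by rewrite -natr1; ring.
  rewrite /b /riccati_coef conv_coefS -/riccati_coef.
  set S := \sum_(_ <= _ < _) _.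
  have B0 := caputo_beta_gt0 alpha alpha01 _ (anS_gt0 n).
  rewrite /caputo_ratio; field; rewrite !gt_eqF//=.
under eq_eseriesr do rewrite Ik.
have cvg2 := conv_pseries_sq_cvg caputo_ratio riccati_coef caputo_ratio_gt0
  erefl (conv_coefS _) (t `^ alpha) (powR_ge0 _ _) (coef_cvg _ _).
apply/cvg_lim => //; under eq_cvg do rewrite sumEFin.
apply: cvg_EFin; first exact: nearW.
rewrite (_ : fine \o _ = (fun N => Gamma (1 - alpha) *
  pseries (fun n => \sum_(0 <= i < n.+1) riccati_coef i * riccati_coef (n - i)%N)
    (t `^ alpha) N)); last first.
  by apply/funext => N /=; rewrite /pseries /series/= mulr_sumr.
apply: cvgM; first exact: cvg_cst.
by apply: cvg2; rewrite powR_ge0.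
Qed.

Lemma integrable_frac_fun1 (t : R) : 0 < t -> t `^ alpha < rho ->
  mu.-integrable `]0, t[ (EFin \o (fun x => V 1%N x / (t - x) `^ alpha)).
Proof.
move=> t0 trho; apply/integrableP; split.
  apply/measurable_EFinP; apply: measurable_funM.
    apply: open_continuous_measurable_fun; first exact: interval_open.
    move=> x; rewrite inE/= in_itv/= => /[dup] x0t /andP[x0 _].
    apply: differentiable_continuous; apply/derivable1_diffP.
    by have [] := is_derive_frac_fun _ _ _ coef_cvg 1%N _ x0 (lt_powR_rho _ _ trho x0t).
  (* The bare kernel is the case [g = 1] of [measurable_powR_conv]. *)
  rewrite (_ : (fun x => _) = (fun x => x `^ (1 - 1) / (t - x) `^ alpha)).
    exact: measurable_powR_conv.
  by apply/funext => x; rewrite subrr powRr0 mul1r.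
rewrite (@eq_integral _ _ _ mu _
  (EFin \o (fun x => V 1%N x / (t - x) `^ alpha))); last first.
  move=> x; rewrite inE/= in_itv/= => /[dup] x0t /andP[x0 _].
  rewrite ger0_norm// divr_ge0 ?powR_ge0// frac_fun1_ge0//.
  exact: lt_powR_rho trho x0t.
by rewrite integral_frac_fun1// ltry.
Qed.

End CaputoRiccati.

(** * Regularity and blow-up of the separated function *)

Section Profile.
Context {R : realType}.

Lemma continuous_max0_powR (alpha : R) : 0 < alpha ->
  continuous (fun t : R => Num.max 0 t `^ alpha).
Proof.
move=> a0 t; have [t0|t0] := ltP 0 t.
  have near_t : \forall y \near t, y `^ alpha = Num.max 0 y `^ alpha.
    near=> y; congr (_ `^ _); apply/esym/max_idPr; apply: ltW.
    by near: y; exact: lt_nbhsr.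
  apply: cvg_trans (near_eq_cvg near_t) _ => /=.
  by rewrite (max_idPr (ltW t0)); exact: continuous_powR_gt0.
have g0 : Num.max 0 t `^ alpha = 0.
  by rewrite (max_idPl t0) powR0 ?gt_eqF.
apply/cvgrPdist_lt => e e0.
have e'0 : 0 < e `^ alpha^-1 by exact: powR_gt0.
near=> y.
rewrite /= g0 sub0r normrN ger0_norm ?powR_ge0//.
have -> : e = (e `^ alpha^-1) `^ alpha.
  by rewrite -powRrM mulVf ?gt_eqF// powRr1// ltW.
apply: gt0_ltr_powR => //; rewrite ?nnegrE ?le_max ?lexx ?powR_ge0//.
rewrite gt_max e'0/=; near: y; apply: lt_nbhsl.
exact: le_lt_trans e'0.
Unshelve. all: by end_near. Qed.

Definition oppr_deriv (n : nat) (x : R) : R :=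
  match n with 0%N => - x | 1%N => -1 | _ => 0 end.

Lemma is_derive_oppr_deriv (n : nat) (x : R) :
  is_derive x 1 (oppr_deriv n) (oppr_deriv n.+1 x).
Proof.
case: n => [|[|n]]; rewrite /oppr_deriv /=.
- by apply: is_derive_eq.
- exact: is_derive_cst.
- exact: is_derive_cst.
Qed.

Lemma continuous_oppr_deriv (n : nat) : continuous (oppr_deriv n).
Proof.
move=> x; apply: differentiable_continuous; apply/derivable1_diffP.
by have [] := is_derive_oppr_deriv n x.
Qed.

Variables (alpha rho : R) (c : nat -> R).
Hypotheses (alpha_gt0 : 0 < alpha) (rho_gt0 : 0 < rho).
Hypothesis c_cvg : pseries_cvg_below rho c.

(** The truncation extends the series by its initial value to [t < 0], where [powR] takes default
    values; continuity at 0 then holds on both sides. *)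
Definition profile (t : R) : R := limn (pseries c (Num.max 0 t `^ alpha)).

Definition lifespan : R := rho `^ alpha^-1.

Definition separated (x t : R) : R := - x * profile t.

Notation V := (frac_fun alpha c).

Lemma lifespan_gt0 : 0 < lifespan. Proof. exact: powR_gt0. Qed.

Lemma lifespan_powR : lifespan `^ alpha = rho.
Proof. by rewrite /lifespan -powRrM mulVf ?gt_eqF// powRr1// ltW. Qed.

Lemma powR_lt_lifespan (t : R) : 0 <= t -> t < lifespan -> t `^ alpha < rho.
Proof.
move=> t0 tT; rewrite -lifespan_powR.
by apply: gt0_ltr_powR; rewrite ?nnegrE ?(ltW lifespan_gt0).
Qed.

Lemma profileE (t : R) : 0 < t -> profile t = V 0%N t.
Proof.
by move=> t0; rewrite /profile /frac_fun oppr0 powRr0 mul1r (max_idPr (ltW t0)).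
Qed.

Lemma continuous_profile (t : R) : t < lifespan -> {for t, continuous profile}.
Proof.
move=> tT; apply: (@cvg_comp _ _ _ (fun t : R => Num.max 0 t `^ alpha)
  (fun s => limn (pseries c s)) _ (nbhs (Num.max 0 t `^ alpha))).
  exact: continuous_max0_powR.
apply: continuous_pseries c_cvg _; rewrite powR_ge0/=.
apply: powR_lt_lifespan; first by rewrite le_max lexx.
by rewrite gt_max lifespan_gt0.
Qed.

Lemma is_derive_frac_fun_lifespan (k : nat) (t : R) : 0 < t < lifespan ->
  is_derive t 1 (V k) (V k.+1 t).
Proof.
move=> /andP[t0 tT]; apply: (is_derive_frac_fun _ _ _ c_cvg) => //.
by apply: powR_lt_lifespan => //; exact: ltW.
Qed.

(** Agreement on the open lifespan is enough because derivatives are local; the closed form of the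
    iterated partials is known only there. *)
Lemma is_derive_separated_t (f : R -> R) (a : R) (k : nat) (t : R) :
  0 < t < lifespan -> (forall s, 0 < s < lifespan -> f s = a * V k s) ->
  is_derive t 1 f (a * V k.+1 t).
Proof.
move=> t0T fE; apply: (@near_eq_is_derive _ _ _ (fun s => a * V k s)).
  case/andP: t0T => t0 tT; near=> s; rewrite fE//; apply/andP; split.
    by near: s; exact: lt_nbhsr.
  by near: s; exact: lt_nbhsl.
have dV := is_derive_frac_fun_lifespan k t t0T.
have h := is_deriveZ a dV.
exact: h.
Unshelve. all: by end_near. Qed.

Lemma is_derive_separated_x (n : nat) (a x : R) :
  is_derive x 1 (fun y => oppr_deriv n y * a) (oppr_deriv n.+1 x * a).
Proof.
have -> : (fun y => oppr_deriv n y * a) = a \*: oppr_deriv n.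
  by apply/funext => y; rewrite mulrC.
have h := is_deriveZ a (is_derive_oppr_deriv n x).
by rewrite mulrC; exact: h.
Qed.

(** Each partial derivative acts on one factor of the product, so only the number of derivatives of
    each kind matters, not their order. *)
Lemma iter_partial_separated (w : seq bool) (x t : R) : 0 < t < lifespan ->
  iter_partial w separated x t =
  oppr_deriv (count negb w) x * V (count id w) t.
Proof.
elim: w x t => [|[] w IH] x t t0T /=.
- by case/andP: t0T => t0 _; rewrite /separated profileE.
- rewrite /partial_t derive1E.
  have [_ ->] := is_derive_separated_t _ _ (count id w) t t0T (fun s => IH x s).
  by [].
- rewrite /partial_x derive1E.
  have -> : (iter_partial w separated)^~ t =
      (fun y => oppr_deriv (count negb w) y * V (count id w) t).
    by apply/funext => y; exact: IH.
  have [_ ->] := is_derive_separated_x (count negb w) (V (count id w) t) x.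
  by [].
Qed.

Lemma derive1n_separated (n : nat) (t : R) :
  (separated^~ t)^`(n) = (fun x => oppr_deriv n x * profile t).
Proof.
elim: n => [//|n IH]; apply/funext => x.
rewrite [LHS](_ : _ = ((separated^~ t)^`(n))^`() x)// IH derive1E.
by have [_ ->] := is_derive_separated_x n (profile t) x.
Qed.

Lemma smooth1_separated (t : R) : smooth1 (separated^~ t).
Proof.
move=> n x; rewrite derive1n_separated.
by have [] := is_derive_separated_x n (profile t) x.
Qed.

Lemma smooth_until_separated : smooth_until lifespan separated.
Proof.
split.
- move=> w; split.
    move=> [x t] /= t0T; split.
      have -> : (iter_partial w separated)^~ t =
          (fun y => oppr_deriv (count negb w) y * V (count id w) t).
        by apply/funext => y; exact: iter_partial_separated.
      by have [] := is_derive_separated_x (count negb w) (V (count id w) t) x.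
    by have [] := is_derive_separated_t _ _ (count id w) t t0T
      (fun s => iter_partial_separated w x s).
  apply: (@subspace_eq_continuous _ _ _
    (fun p : R * R => oppr_deriv (count negb w) p.1 * V (count id w) p.2)).
    by move=> [x t]; rewrite inE/= => t0T; rewrite -iter_partial_separated.
  apply: continuous_in_subspaceT => -[x t]; rewrite inE/= => t0T.
  apply: (@cvgM _ _ _ _ (fun p : R * R => oppr_deriv (count negb w) p.1)
    (fun p : R * R => V (count id w) p.2)).
    apply: (@cvg_comp _ _ _ fst (oppr_deriv (count negb w)) _ (nbhs x)).
      exact: cvg_fst.
    exact: continuous_oppr_deriv.
  apply: (@cvg_comp _ _ _ snd (V (count id w)) _ (nbhs t)); first exact: cvg_snd.
  apply: differentiable_continuous; apply/derivable1_diffP.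
  by have [] := is_derive_frac_fun_lifespan (count id w) t t0T.
- by move=> t _; exact: smooth1_separated.
- move=> n.
  have -> : (fun p : R * R => (separated^~ p.2)^`(n) p.1) =
      (fun p => oppr_deriv n p.1 * profile p.2).
    by apply/funext => p; rewrite derive1n_separated.
  apply: continuous_in_subspaceT => -[x t]; rewrite inE/= => /andP[_ tT].
  apply: (@cvgM _ _ _ _ (fun p : R * R => oppr_deriv n p.1)
    (fun p : R * R => profile p.2)).
    apply: (@cvg_comp _ _ _ fst (oppr_deriv n) _ (nbhs x)).
      exact: cvg_fst.
    exact: continuous_oppr_deriv.
  apply: (@cvg_comp _ _ _ snd profile _ (nbhs t)); first exact: cvg_snd.
  exact: continuous_profile.
Qed.

Lemma profile_blowup (t : nat -> R) :
  limn (pseries c s) @[s --> rho^'-] --> +oo ->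
  (forall n, 0 <= t n < lifespan) -> t @ \oo --> lifespan ->
  profile (t n) @[n --> \oo] --> +oo.
Proof.
move=> Foo t0T tT; apply/cvgryPge => M.
move/cvgryPge : Foo => /(_ M); rewrite /at_left near_withinE => nearF.
have ta : (t n) `^ alpha @[n --> \oo] --> rho.
  rewrite -lifespan_powR.
  apply: (@cvg_comp _ _ _ t (@powR R ^~ alpha) _ (nbhs lifespan)) => //.
  exact: continuous_powR_gt0 _ _ lifespan_gt0.
near=> n.
have h : t n `^ alpha < rho -> M <= limn (pseries c (t n `^ alpha)).
  by near: n; exact: (ta _ nearF).
case/andP: (t0T n) => t0 tnT.
by rewrite /profile (max_idPr t0); apply: h; exact: powR_lt_lifespan.
Unshelve. all: by end_near. Qed.

End Profile.

(** * The Burgers equation and the blow-up sequence *)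

Section Burgers.
Context {R : realType}.
Variables (alpha rho : R) (alpha01 : 0 < alpha < 1) (rho_gt0 : 0 < rho).
Hypothesis coef_cvg : pseries_cvg_below rho (riccati_coef alpha).

Notation c := (riccati_coef alpha).
Notation v := (profile alpha c).
Notation u := (separated alpha c).
Notation T := (lifespan alpha rho).

Let alpha_gt0 : 0 < alpha. Proof. by case/andP: alpha01. Qed.

Lemma profile0 : v 0 = 1.
Proof.
rewrite /profile maxxx powR0 ?gt_eqF//; apply/cvg_lim => //.
rewrite -cvg_shiftS/=.
have -> : (fun n => pseries c 0 n.+1) = (fun=> 1).
  apply/funext => n; rewrite /pseries /series/= big_nat_recl//= big1 ?addr0.
    by rewrite expr0 mulr1.
  by move=> i _; rewrite expr0n mulr0.
exact: cvg_cst.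
Qed.

Lemma caputo_integrand_separated (x t tau : R) : 0 < tau < t -> t < T ->
  caputo_integrand alpha (u x) t tau =
  - x * (frac_fun alpha c 1 tau / (t - tau) `^ alpha).
Proof.
move=> /andP[tau0 taut] tT; rewrite /caputo_integrand mulrA; congr (_ / _).
have := iter_partial_separated alpha rho c alpha_gt0 rho_gt0 coef_cvg
  [:: true] x tau _.
by apply; rewrite tau0 (lt_trans taut).
Qed.

Lemma burgers_solution_separated : burgers_solution alpha T (fun x => - x) u.
Proof.
split; last by move=> x; rewrite /separated profile0 mulr1.
move=> x t /andP[t0 tT].
have trho := powR_lt_lifespan _ _ alpha_gt0 rho_gt0 _ (ltW t0) tT.
have iV := integrable_frac_fun1 alpha alpha01 rho coef_cvg t t0 trho.
have eqc : {in `]0, t[%classic, caputo_integrand alpha (u x) t =1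
    (fun tau => - x * (frac_fun alpha c 1 tau / (t - tau) `^ alpha))}.
  move=> tau; rewrite inE/= in_itv/= => tau0t.
  exact: caputo_integrand_separated.
split.
  split.
    move=> tau /andP[tau0 taut].
    have t0T : 0 < tau < T by rewrite tau0 (lt_trans taut).
    have [] := is_derive_separated_t alpha rho c alpha_gt0 rho_gt0 coef_cvg
      (u x) (- x) 0 tau t0T _ => // s /andP[s0 _].
    by rewrite /separated profileE.
  have ixV : lebesgue_measure.-integrable `]0, t[ (fun tau =>
      ((- x)%:E * (frac_fun alpha c 1 tau / (t - tau) `^ alpha)%:E)%E).
    by apply: integrableZl iV.
  apply: eq_integrable ixV => // tau tau0t.
  by rewrite /= eqc// EFinM.
have -> : caputo alpha 0 (u x) t =
    (Gamma (1 - alpha))^-1 * (- x * (Gamma (1 - alpha) * v t ^+ 2)).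
  rewrite /caputo; congr (_ * _).
  transitivity (\int[lebesgue_measure]_(tau in `]0, t[)
      (- x * (frac_fun alpha c 1 tau / (t - tau) `^ alpha))).
    exact: eq_Rintegral.
  rewrite RintegralZl//; congr (_ * _).
  rewrite /Rintegral (integral_frac_fun1 alpha alpha01 rho)//=.
  by rewrite /profile (max_idPr (ltW t0)).
have -> : partial_x u x t = - v t.
  have /(congr1 (fun f => f x)) /= := derive1n_separated alpha c 1 t.
  by rewrite mulN1r.
have G0 : Gamma (1 - alpha) != 0.
  by rewrite gt_eqF// Gamma_gt0//; case/andP: alpha01 => *; lra.
by rewrite /separated; field.
Qed.

End Burgers.

Theorem theorem1p2 (R : realType) (alpha : R) (halpha : 0 < alpha < 1) :
  exists (T : R) (u0 : R -> R) (u : R -> R -> R) (t : nat -> R),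
    [/\ 0 < T,
        smooth1 u0,
        smooth_until T u /\ burgers_solution alpha T u0 u,
        [/\ forall n, 0 <= t n < T, increasing_seq t & t @ \oo --> T] &
        (forall x : R, x < 0 -> (fun n => u x (t n)) @ \oo --> +oo) /\
        (forall x : R, 0 < x -> (fun n => u x (t n)) @ \oo --> -oo)].
Proof.
have alpha_gt0 : 0 < alpha by case/andP: halpha.
have [rho [rho_gt0 coef_cvg Foo]] := riccati_coef_blowup alpha halpha.
pose T := lifespan alpha rho; pose u := separated alpha (riccati_coef alpha).
have T0 : 0 < T by exact: lifespan_gt0.
(* The sequence starts at [t 0 = 0], which is admissible since time 0 belongs to the domain. *)
pose t (n : nat) := T - T / n.+1%:R.
have t0T n : 0 <= t n < T.
  rewrite /t subr_ge0 gtrBl divr_gt0// andbT ler_pdivrMr// ler_peMr ?(ltW T0)//.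
  by rewrite ler1n.
have tT : t @ \oo --> T.
  rewrite -[X in _ --> X]subr0 -[X in _ - X](mulr0 T).
  apply: cvgB; first exact: cvg_cst.
  by apply: cvgM; [exact: cvg_cst|exact: cvg_harmonic].
have voo := profile_blowup alpha rho _ alpha_gt0 rho_gt0 t Foo t0T tT.
exists T, (fun x => - x), u, t; split; first exact: T0.
- have -> : (fun x : R => - x) = u^~ 0.
    by apply/funext => x; rewrite /u /separated profile0 ?mulr1.
  exact: smooth1_separated.
- split; first exact: smooth_until_separated.
  exact: burgers_solution_separated.
- split; [exact: t0T| |exact: tT] => n m.
  by rewrite /t lerD2l lerN2 ler_pM2l// lef_pV2 ?posrE// ler_nat ltnS.
split=> x x0; rewrite /u /separated.
  apply/cvgryPge => M; move/cvgryPge : voo => /(_ (M / - x)).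
  by apply: filterS => n; rewrite ler_pdivrMr ?oppr_gt0// mulrC.
apply/cvgrNyPle => M; move/cvgryPge : voo => /(_ (- M / x)).
apply: filterS => n; rewrite ler_pdivrMr// => h.
by rewrite mulNr mulrC; lra.
Qed.
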